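(* Define $p_1:=0$ and $p_k:=\frac{2\log(1+1/k)}{\log(1+2/(k-1))}$ for integers $k\ge 2$, and for $p\in (p_{k-1},p_k]$ define $\tau(p):=k^{1-2/p}(k-1)$. Let $p\in(0,1)$ and let $\rho$ be a symmetric probability measure on $\mathbb{R}$ with finite $p$-th moment such that, for $X\sim\rho$, $\mathbb{P}(X=0)=0$ and one of the following holds: (1) there are $C>0$ and $\alpha_1<2-p$ such that $|\log\mathbb{P}(x\le X\le t x)|\le Cx^{\alpha_1}$ as $x\to \infty$ and $t\downarrow 1$; (2) there are $C>0$ and $\alpha_2<2(1-p)$ such that $|\log\mathbb{P}(|X|<x)|\le C x^{-\alpha_2}$ as $x\to 0$. Then for $\beta>0$, \[ \lim_{n\to\infty}n^{1-2/p}\log \mathcal{Z}_{n,p}(\beta;\rho) = \frac{\beta}{2}\tau(p). \]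
   Context: For $\|x\|_{n,p}:=(\frac1n\sum_{i=1}^n|x_i|^p)^{1/p}$, the self-scaled partition function is $\mathcal{Z}_{n,p}(\beta;\rho) = \int_{\mathbb{R}^{n}} \exp\left(\frac{\beta n}{2}\cdot \frac{|n^{-1}\sum_{i}x_i|^2}{\|x\|_{n,p}^2} - \frac{\beta}{2}\cdot \frac{n^{-1}\sum_{i}x_i^2}{\|x\|_{n,p}^2} \right) \prod_{i=1}^{n}d\rho(x_{i})$. *)

(* Defs.v *)
From HB Require Import structures.
From mathcomp Require Import all_boot all_order all_algebra.
From mathcomp Require Import all_classical all_reals all_analysis.
Set Implicit Arguments. Unset Strict Implicit. Unset Printing Implicit Defensive.
Import Order.TTheory GRing.Theory Num.Theory.
Import numFieldNormedType.Exports.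
Local Open Scope classical_set_scope.
Local Open Scope ring_scope.

Section Defs.
Context {R : realType}.

(* p_1 := 0, p_k := 2 log(1+1/k) / log(1 + 2/(k-1)) for k >= 2
   (p_0 is irrelevant; set to 0 as well). *)
Definition pk (k : nat) : R :=
  if (k <= 1)%N then 0
  else 2 * ln (1 + k%:R^-1) / ln (1 + 2 / (k%:R - 1)).

Definition tau (p : R) : R :=
  let k := xget 0%N [set k : nat | (2 <= k)%N /\ pk k.-1 < p <= pk k] in
  k%:R `^ (1 - 2 / p) * (k%:R - 1).

Definition normnp (p : R) (x : seq R) : R :=
  ((size x)%:R^-1 * \sum_(xi <- x) `|xi| `^ p) `^ p^-1.

Definition Zintegrand (p beta : R) (x : seq R) : R :=
  let n := (size x)%:R in
  expR (beta * n / 2 * ((n^-1 * \sum_(xi <- x) xi) ^+ 2) / (normnp p x) ^+ 2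
        - beta / 2 * (n^-1 * \sum_(xi <- x) xi ^+ 2) / (normnp p x) ^+ 2).

(* Integral against the n-fold product measure rho^{(x) n} of a nonnegative
   function of (x_1, ..., x_n), written as the iterated integral (equal to the
   product-measure integral by Tonelli, the library having no n-fold product). *)
Fixpoint iter_int (rho : {measure set R -> \bar R}) (n : nat)
    (F : seq R -> \bar R) : \bar R :=
  match n with
  | 0 => F [::]
  | m.+1 => (\int[rho]_x iter_int rho m (fun s => F (x :: s)))%E
  end.

Definition Znp (n : nat) (p beta : R) (rho : {measure set R -> \bar R}) : \bar R :=
  iter_int rho n (fun x => (Zintegrand p beta x)%:E).

End Defs.

(* Main.v *)
Require Import Defs.
From HB Require Import structures.
From mathcomp Require Import all_boot all_order all_algebra.
From mathcomp Require Import all_classical all_reals all_analysis.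
From mathcomp Require Import measurable_realfun ring lra.
Set Implicit Arguments. Unset Strict Implicit. Unset Printing Implicit Defensive.
Import Order.TTheory GRing.Theory Num.Theory.
Import numFieldNormedType.Exports.
Local Open Scope classical_set_scope.
Local Open Scope ring_scope.

(** The exponent in the integrand is [beta / 2 * n^(2/p - 1)] times the
    scale-invariant ratio [(sum_(i != j) x_i x_j) / (sum_i |x_i|^p)^(2/p)].  Its
    maximum over vectors of any length is [tau p]: in the variables [|x_i|^p],
    moving two coordinates with fixed sum, the ratio is largest either when they
    merge or when they get closer, so one may assume that all nonzero coordinates
    are equal; [k] equal coordinates give [k^(1 - 2/p) (k - 1)], which is unimodal
    in [k] and maximal for the [k] in the definition of [tau].  This is the upper
    bound.  For the lower bound, one integrates over vectors with [k] nearly equal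
    coordinates dominating all others: [k] coordinates of order [n^(1/p)] under
    (1), the remaining ones of order [n^(-1/p)] under (2).  In both cases the log
    of the probability is of smaller order than [n^(2/p - 1)]. *)

(** * Calculus for powers and the two-point inequality *)

(** A rise from [a] to [x] gives, by the mean value theorem, a point before [x] where [h >= 0]; then
    [h] stays nonnegative beyond [x], so [f] cannot fall between [x] and [b]. *)
Lemma monotone_after_rise (R : realType) (f w h : R -> R) (a x b : R) :
  a < x -> x <= b -> {within `[a, b], continuous f} ->
  (forall y, y \in `]a, b[ -> is_derive y 1 f (w y * h y)) ->
  (forall y, y \in `]a, b[ -> 0 < w y) ->
  {in `]a, b[ &, {homo h : y z / y <= z}} ->
  f a <= f x -> f x <= f b.
Proof.
move=> ax; rewrite le_eqVlt => /predU1P[<-//|xb] cf df w0 hmono fax.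
have sub1 : `[a, x] `<=` `[a, b].
  by apply: subset_itvl; rewrite bnd_simp ltW.
have sub2 : `[x, b] `<=` `[a, b].
  by apply: subset_itvr; rewrite bnd_simp ltW.
have in1 y : y \in `]a, x[ -> y \in `]a, b[.
  by rewrite !in_itv/= => /andP[-> /lt_trans->].
have in2 y : y \in `]x, b[ -> y \in `]a, b[.
  by rewrite !in_itv/= => /andP[xy ->]; rewrite (lt_trans ax).
have [c1 c1ax e1] := MVT ax (fun y yax => df y (in1 y yax))
  (continuous_subspaceW sub1 cf).
have [c2 c2xb e2] := MVT xb (fun y yxb => df y (in2 y yxb))
  (continuous_subspaceW sub2 cf).
have c12 : c1 <= c2.
  move: c1ax c2xb; rewrite !in_itv/= => /andP[_ /ltW +] /andP[/ltW + _].
  exact: le_trans.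
have h1 : 0 <= h c1.
  have : 0 <= w c1 * h c1 * (x - a) by rewrite -e1 subr_ge0.
  by rewrite pmulr_lge0 ?subr_gt0// pmulr_rge0// w0//; exact: in1.
have h2 : 0 <= h c2 by apply: (le_trans h1); apply: hmono => //; [exact: in1|exact: in2].
by rewrite -subr_ge0 e2 mulr_ge0 ?subr_ge0 ?(ltW xb)// mulr_ge0// ltW// w0//; exact: in2.
Qed.

(** The absolute value keeps the base nonnegative, so that continuity holds on the whole line, zero
    included. *)
Lemma continuous_powR_norm (R : realType) (r : R) :
  0 < r -> continuous (fun u : R => `|u| `^ r).
Proof.
move=> r0 u; have [->|u0] := eqVneq u 0; last first.
  have nu0 : 0 < `|u| by rewrite normr_gt0.
  apply: (@continuous_comp R^o R^o R^o Num.norm (fun v => v `^ r)).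
    exact: (@norm_continuous R R^o).
  apply: differentiable_continuous; apply/derivable1_diffP.
  by apply: derivable_powR; rewrite in_itv/= nu0.
apply/cvgrPdist_lt => e e0.
rewrite normr0 powR0 ?gt_eqF//; near=> v.
rewrite sub0r normrN ger0_norm ?powR_ge0//.
have -> : e = (e `^ r^-1) `^ r by rewrite -powRrM mulVf ?gt_eqF// powRr1 ?ltW.
apply: gt0_ltr_powR; rewrite ?nnegrE ?powR_ge0//.
by near: v; apply: (@nbhs0_lt R R^o); rewrite powR_gt0.
Unshelve. all: by end_near. Qed.

Lemma is_derive_powR_addl (R : realType) (c a v : R) : 0 < c + v ->
  is_derive v 1 (fun v => (c + v) `^ a) (a * (c + v) `^ (a - 1)).
Proof.
move=> cv.
have d1 : is_derive v 1 (fun v : R => c + v) 1.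
  by rewrite -[X in is_derive _ _ _ X]add0r; apply: is_deriveD.
have d2 := is_derive1_powR a cv.
have := @is_derive1_comp R (fun x => x `^ a) (fun v => c + v) v _ _ d2 d1.
by rewrite mulr1.
Qed.

Lemma is_derive_powR_subl (R : realType) (c a v : R) : 0 < c - v ->
  is_derive v 1 (fun v => (c - v) `^ a) (- (a * (c - v) `^ (a - 1))).
Proof.
move=> cv.
have d1 : is_derive v 1 (fun v : R => c - v) (-1).
  by rewrite -[X in is_derive _ _ _ X]add0r; apply: is_deriveB.
have d2 := is_derive1_powR a cv.
have := @is_derive1_comp R (fun x => x `^ a) (fun v => c - v) v _ _ d2 d1.
by rewrite mulrN1.
Qed.

Lemma le_of_derive_ge0 (R : realType) (f df : R -> R) (a b : R) : a <= b ->
  (forall x, x \in `[a, b] -> is_derive x 1 f (df x)) ->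
  (forall x, x \in `]a, b[ -> 0 <= df x) -> f a <= f b.
Proof.
rewrite le_eqVlt => /predU1P[->//|ab] fd df0.
have fd' x : x \in `]a, b[ -> is_derive x 1 f (df x).
  by move=> xab; apply: fd; exact: subset_itv_oo_cc.
have cf : {within `[a, b], continuous f}.
  by apply: derivable_within_continuous => x /fd[].
have [c cab e] := MVT ab fd' cf.
by rewrite -subr_ge0 e mulr_ge0 ?subr_ge0 ?(ltW ab) ?df0.
Qed.

(** Since [t^(-n)] is convex, its symmetric sum about [c] grows with the spread. *)
Lemma powR_sym_le (R : realType) (c n v w : R) : 0 < n -> 0 <= v -> v <= w -> w < c ->
  (c - v) `^ (- n) + (c + v) `^ (- n) <= (c - w) `^ (- n) + (c + w) `^ (- n).
Proof.
move=> n0 v0 vw wc.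
pose df x : R := - (- n * (c - x) `^ (- n - 1)) + (- n * (c + x) `^ (- n - 1)).
apply: (@le_of_derive_ge0 R
  (fun x => (c - x) `^ (- n) + (c + x) `^ (- n)) df) => // x.
  rewrite in_itv/= => /andP[vx xw]; apply: is_deriveD.
    by apply: is_derive_powR_subl; rewrite subr_gt0 (le_lt_trans xw).
  by apply: is_derive_powR_addl; lra.
rewrite in_itv/= => /andP[vx xw].
rewrite /df !mulNr opprK -mulrBr mulr_ge0 ?(ltW n0)// subr_ge0.
have h1 : 0 < c - x by lra.
have h2 : 0 < c + x by lra.
rewrite -opprD !powRN lef_pV2 ?posrE ?powR_gt0//.
by apply: ge0_ler_powR; rewrite ?nnegrE; lra.
Qed.

(** The difference vanishes at 0 and its derivative is nondecreasing by [powR_sym_le]; by convexity,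
    the slopes of its chords from the origin increase. *)
Lemma powR_chord_le (R : realType) (c m v w : R) : 0 < m -> 0 < v -> v <= w -> w < c ->
  ((c - v) `^ (- m) - (c + v) `^ (- m)) / v <=
  ((c - w) `^ (- m) - (c + w) `^ (- m)) / w.
Proof.
move=> m0 v0; rewrite le_eqVlt => /predU1P[->//|vw] wc.
pose g x : R := (c - x) `^ (- m) - (c + x) `^ (- m).
pose dg x : R := m * ((c - x) `^ (- (m + 1)) + (c + x) `^ (- (m + 1))).
have dgP x : 0 <= x -> x < c -> is_derive x 1 g (dg x).
  move=> x0 xc.
  have -> : dg x = - (- m * (c - x) `^ (- m - 1)) - (- m * (c + x) `^ (- m - 1)).
    by rewrite /dg [- (m + 1)]opprD; ring.
  apply: is_deriveB.
    by apply: is_derive_powR_subl; lra.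
  by apply: is_derive_powR_addl; lra.
have cont a b : 0 <= a -> b < c -> {within `[a, b], continuous g}.
  move=> a0 bc; apply: derivable_within_continuous => x.
  rewrite in_itv/= => /andP[ax xb].
  by case: (dgP x (le_trans a0 ax) (le_lt_trans xb bc)).
have vc : v < c by lra.
have d1 x : x \in `]0, v[ -> is_derive x 1 g (dg x).
  by rewrite in_itv/= => /andP[? ?]; apply: dgP; lra.
have d2 x : x \in `]v, w[ -> is_derive x 1 g (dg x).
  by rewrite in_itv/= => /andP[? ?]; apply: dgP; lra.
have [x1 + e1] := MVT v0 d1 (cont 0 v (lexx _) vc).
have [x2 + e2] := MVT vw d2 (cont v w (ltW v0) wc).
rewrite !in_itv/= => /andP[vx2 x2w] /andP[x10 x1v].
have dg12 : dg x1 <= dg x2.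
  by rewrite ler_pM2l//; apply: powR_sym_le; lra.
have g0 : g 0 = 0 by rewrite /g subr0 addr0 subrr.
rewrite -/(g v) -/(g w).
have ev : g v = dg x1 * v by move: e1; rewrite g0 !subr0.
have ew : g w = dg x1 * v + dg x2 * (w - v) by rewrite -e2 -ev; ring.
rewrite ew ev mulfK ?gt_eqF// ler_pdivlMr; last lra.
nra.
Qed.

(* With [a, b = c +- u], the [u]-derivative of [T (a^r + b^r) + (a b)^r] is
   [r (a b)^(r-1)] times [T (b^(1-r) - a^(1-r)) - 2 u], whose quotient by [u] is
   nondecreasing by [powR_chord_le]: along the segment the maximum is at an end. *)
Lemma two_point_smoothing (R : realType) (r T a b a' b' : R) :
  1 < r -> 0 <= T -> 0 <= b -> b <= b' -> b' <= a' -> a' + b' = a + b ->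
  T * (a `^ r + b `^ r) + a `^ r * b `^ r <=
  Num.max (T * (a' `^ r + b' `^ r) + a' `^ r * b' `^ r) (T * (a + b) `^ r).
Proof.
move=> r1 T0 b0 bb' ba' ab.
have [bE|b_neq] := eqVneq b b'.
  have -> : a = a' by lra.
  by rewrite bE le_max lexx.
have {bb' b_neq}bb' : b < b' by rewrite lt_neqAle b_neq.
(* Half-gaps around the common mean [c]: [x] for [(a, b)] and [v] for [(a', b')]; the value [u = c]
   is the merged pair [(a + b, 0)]. *)
pose c : R := (a + b) / 2; pose v : R := (a' - b') / 2; pose x : R := (a - b) / 2.
have ax : a = c + x by rewrite /c /x; lra.
have bx : b = c - x by rewrite /c /x; lra.
have av : a' = c + v by rewrite /c /v; lra.
have bv : b' = c - v by rewrite /c /v; lra.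
have v0 : 0 <= v by rewrite /v; lra.
have vx : v < x by lra.
have xc : x <= c by lra.
pose m := r - 1.
have m0 : 0 < m by rewrite /m; lra.
have r0 : 0 < r by lra.
pose f (u : R) := T * ((c + u) `^ r + (c - u) `^ r) + (c + u) `^ r * (c - u) `^ r.
pose w (u : R) := r * (c + u) `^ m * (c - u) `^ m * u.
pose h (u : R) := T * (((c - u) `^ (- m) - (c + u) `^ (- m)) / u) - 2.
have fc : f c = T * (a + b) `^ r.
  rewrite /f subrr powR0 ?gt_eqF// mulr0 !addr0.
  by congr (_ * _ `^ _); rewrite /c; lra.
have fa : f v = T * (a' `^ r + b' `^ r) + a' `^ r * b' `^ r by rewrite av bv.
rewrite -fc -fa ax bx -/(f x) le_max.
(* If [f x] exceeds [f v], then [f] has risen from [v] to [x], and [monotone_after_rise] carries the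
   rise on to [c]. *)
have [fvx|/ltW ->//] := leP (f v) (f x).
apply/orP; right.
have fcont : {within `[v, c], continuous f}.
  (* On the segment [f] agrees with [g], which is continuous also at [u = c], where the base [c - u]
     vanishes. *)
  pose g (u : R) := T * (`|c + u| `^ r + `|c - u| `^ r) + `|c + u| `^ r * `|c - u| `^ r.
  apply: (@subspace_eq_continuous _ _ _ g).
    move=> u; rewrite inE/= in_itv/= => /andP[vu uc].
    by rewrite /g /f !ger0_norm//; lra.
  apply: continuous_subspaceT => u.
  have cp : {for u, continuous (fun u : R => `|c + u| `^ r)}.
    apply: (@continuous_comp R^o R^o R^o (fun u => c + u) (fun v => `|v| `^ r)).
      by apply: cvgD; [exact: cvg_cst|exact: cvg_id].
    exact: continuous_powR_norm.
  have cm : {for u, continuous (fun u : R => `|c - u| `^ r)}.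
    apply: (@continuous_comp R^o R^o R^o (fun u => c - u) (fun v => `|v| `^ r)).
      by apply: cvgB; [exact: cvg_cst|exact: cvg_id].
    exact: continuous_powR_norm.
  apply: cvgD; last by apply: cvgM.
  by apply: cvgM; [exact: cvg_cst|apply: cvgD].
apply: (@monotone_after_rise _ f w h v x c) => //.
- move=> y; rewrite in_itv/= => /andP[vy yc].
  have cy : 0 < c + y by lra.
  have cy' : 0 < c - y by lra.
  have d1 := @is_derive_powR_addl R c r y cy.
  have d2 := @is_derive_powR_subl R c r y cy'.
  have -> : w y * h y = T *: (r * (c + y) `^ (r - 1) + - (r * (c - y) `^ (r - 1)))
     + ((c + y) `^ r *: (- (r * (c - y) `^ (r - 1)))
     + (c - y) `^ r *: (r * (c + y) `^ (r - 1))).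
    rewrite /GRing.scale/= -/m /w /h.
    have pE z : 0 < z -> z `^ r = z * z `^ m.
      by move=> z0; rewrite mulr_powRB1// ltW.
    rewrite !pE// !powRN.
    have p1 : (c + y) `^ m != 0 by rewrite gt_eqF// powR_gt0.
    have p2 : (c - y) `^ m != 0 by rewrite gt_eqF// powR_gt0.
    have y0 : y != 0 by rewrite gt_eqF//; lra.
    by field; rewrite y0 p1 p2.
  have d3 := is_deriveD d1 d2.
  have d4 := is_deriveZ T d3.
  have d5 := is_deriveM d1 d2.
  exact: (is_deriveD d4 d5).
- move=> y; rewrite in_itv/= => /andP[vy yc].
  by rewrite /w !mulr_gt0// ?powR_gt0//; lra.
- move=> y z; rewrite !in_itv/= => /andP[vy yc] /andP[vz zc] yz.
  rewrite /h lerD2r ler_wpM2l//.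
  by apply: powR_chord_le => //; lra.
Qed.

(** * Maximizing the pair sum over nonnegative vectors *)

(** The deviations from [mu] sum to zero, so if none were positive, or none negative, all would
    vanish. *)
Lemma exists_gt_and_lt_mean (R : realFieldType) (s : seq R) (mu : R) :
  \sum_(t <- s) t = (size s)%:R * mu -> has (fun t => t != mu) s ->
  exists a b z, [/\ perm_eq s [:: a, b & z], mu < a & b < mu].
Proof.
move=> sE hs.
have sum0 : \sum_(t <- s) (t - mu) = 0.
  by rewrite sumrB sE big_const_seq count_predT iter_addr_0 mulr_natl subrr.
have [a as_ amu] : exists2 a, a \in s & mu < a.
  apply/hasP; apply: contraT => /hasPn nh.
  have : \sum_(t <- s | t \in s) (mu - t) == 0.
    rewrite -big_seq; under eq_bigr do rewrite -opprB.
    by rewrite sumrN sum0 oppr0.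
  rewrite psumr_eq0; last by move=> t /nh; rewrite -leNgt subr_ge0.
  move=> /allP h; case/hasP: hs => t ts; apply: contraNT => _.
  by have := h _ ts; rewrite ts/= subr_eq0 eq_sym.
have [b bs bmu] : exists2 b, b \in s & b < mu.
  apply/hasP; apply: contraT => /hasPn nh.
  have : \sum_(t <- s | t \in s) (t - mu) == 0 by rewrite -big_seq sum0.
  rewrite psumr_eq0; last by move=> t /nh; rewrite -leNgt subr_ge0.
  move=> /allP h; case/hasP: hs => t ts; apply: contraNT => _.
  by have := h _ ts; rewrite ts/= subr_eq0.
exists a, b, (rem b (rem a s)); split => //.
have pa := perm_to_rem as_.
have br : b \in rem a s.
  by move: bs; rewrite (perm_mem pa) inE lt_eqF ?(lt_trans bmu).
by rewrite (perm_trans pa)// perm_cons perm_to_rem.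
Qed.

(** Induction on the length, then on the number of entries different from the mean. Two entries on
    either side of the mean are moved until one reaches it, or are merged, as [two_point_smoothing]
    dictates. When all entries equal the mean, homogeneity reduces the bound to the hypothesis on
    [M]. *)
Lemma pair_sum_le (R : realType) (r M : R) (y : seq R) : 1 < r ->
  (forall n : nat, (0 < n)%N -> n%:R `^ (1 - 2 * r) * (n%:R - 1) <= M) ->
  all (fun t => 0 <= t) y ->
  (\sum_(t <- y) t `^ r) ^+ 2 - \sum_(t <- y) (t `^ r) ^+ 2
    <= M * (\sum_(t <- y) t) `^ (2 * r).
Proof.
move=> r1 HM; have r0 : 0 < r by lra.
pose G (y : seq R) := (\sum_(t <- y) t `^ r) ^+ 2 - \sum_(t <- y) (t `^ r) ^+ 2.
have Gperm y1 y2 : perm_eq y1 y2 -> G y1 = G y2.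
  by move=> p12; rewrite /G !(perm_big _ p12).
have G2 a b z : G [:: a, b & z] =
    2 * ((\sum_(t <- z) t `^ r) * (a `^ r + b `^ r) + a `^ r * b `^ r) + G z.
  by rewrite /G !big_cons; ring.
have G1 a z : G (a :: z) = 2 * ((\sum_(t <- z) t `^ r) * a `^ r) + G z.
  by rewrite /G !big_cons; ring.
rewrite -/(G y); have [n] := ubnP (size y); elim: n y => // n IHn y.
rewrite ltnS leq_eqVlt => /predU1P[yn|]; last exact: IHn.
case: n IHn yn => [_ /size0nil -> _|n IHn yn].
  by rewrite /G !big_nil powR0 ?mulr0 ?subr0 ?expr0n// gt_eqF//; lra.
(* The sum, hence [mu], must stay fixed while the inner induction changes the list; so [s] is made
   opaque and tied to [y] by [sE] alone. *)
set s := \sum_(t <- y) t; have sE : \sum_(t <- y) t = s by [].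
clearbody s; pose mu := s / n.+1%:R.
have smu : s = n.+1%:R * mu by rewrite mulrC divfK// pnatr_eq0.
have [k] := ubnP (count (fun t => t != mu) y).
elim: k y yn sE => // k IHk y yn sE ck y0.
have [hs|hs] := boolP (has (fun t => t != mu) y); last first.
  have mu0 : 0 <= mu.
    rewrite divr_ge0// -sE big_seq; apply: sumr_ge0 => t.
    by move/allP: y0; apply.
  have yE : y = nseq n.+1 mu.
    rewrite -yn; apply/all_pred1P/allP => t ty /=.
    by move/hasPn : hs => /(_ _ ty); rewrite negbK.
  have mu2 : mu `^ (2 * r) = (mu `^ r) ^+ 2.
    by rewrite -powR_mulrn ?powR_ge0// -powRrM mulrC.
  rewrite smu powRM// mu2 /G yE !big_nseq !iter_addr_0.
  set u := mu `^ r; rewrite -[u *+ _]mulr_natl -[u ^+ 2 *+ _]mulr_natl.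
  set N : R := n.+1%:R.
  have N0 : 0 < N by rewrite /N.
  have NE : N = N `^ (1 - 2 * r) * N `^ (2 * r).
    by rewrite -powRD ?subrK ?powRr1 ?(ltW N0) ?(gt_eqF N0) ?implybT.
  have -> : (N * u) ^+ 2 - N * u ^+ 2
      = N `^ (1 - 2 * r) * (N - 1) * (N `^ (2 * r) * u ^+ 2).
    transitivity (N `^ (1 - 2 * r) * N `^ (2 * r) * (N - 1) * u ^+ 2); last by ring.
    by rewrite -NE; ring.
  by rewrite ler_wpM2r ?HM// mulr_ge0 ?powR_ge0// sqr_ge0.
have sumE : \sum_(t <- y) t = (size y)%:R * mu by rewrite sE yn.
have [a [b [z [yp amu bmu]]]] := exists_gt_and_lt_mean sumE hs.
have yz0 : [&& 0 <= a, 0 <= b & all (fun t => 0 <= t) z].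
  by have := perm_all (fun t => 0 <= t) yp; rewrite y0/= => <-.
case/and3P: yz0 => a0 b0 z0.
have T0 : 0 <= \sum_(t <- z) t `^ r by apply: sumr_ge0 => t _; exact: powR_ge0.
have szz : (size z).+2 = n.+1 by rewrite -yn (perm_size yp).
have sz : a + (b + \sum_(t <- z) t) = s by rewrite -sE (perm_big _ yp)/= !big_cons.
(* One of the two new entries is exactly [mu], and the sum is kept. *)
pose a' := Num.max mu (a + b - mu); pose b' := Num.min mu (a + b - mu).
have ab' : a' + b' = a + b.
  by rewrite /a' /b' addr_max_min; ring.
have bb' : b <= b' by rewrite le_min; lra.
have ba' : b' <= a' by rewrite ge_min le_max; lra.
have := two_point_smoothing r1 T0 b0 bb' ba' ab'.
rewrite (Gperm _ _ yp) le_max => /orP[h|h].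
  apply: (@le_trans _ _ (G [:: a', b' & z])).
    by rewrite !G2 lerD2r ler_pM2l.
  apply: IHk.
  - by rewrite /= szz.
  - by rewrite !big_cons addrA ab' -addrA.
  (* Both [a] and [b] were counted, while at most one of [a'] and [b'] is. *)
  - move: ck; rewrite (permP yp)/= gt_eqF// lt_eqF//= !add1n !ltnS.
    apply: leq_trans; rewrite addnA ltnS -add1n leq_add2r.
    by rewrite /a' /b'; case: leP => _; rewrite eqxx ?leq_b1//= addn0 leq_b1.
  - by rewrite /= z0 (le_trans b0 bb') (le_trans b0 (le_trans bb' ba')).
(* Merging shortens the list, so the outer induction applies. *)
apply: (@le_trans _ _ (G ((a + b) :: z))).
  by rewrite G2 G1 lerD2r ler_pM2l.
have := IHn ((a + b) :: z); rewrite big_cons -addrA sz; apply.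
  by rewrite /= szz.
by rewrite /= z0 addr_ge0.
Qed.

(** * The sequence [pk] and the maximality of [tau] *)

(** After taking logarithms, [pk k] is seen to be the exponent at which [k] and [k + 1] equal
    coordinates give the same ratio. *)
Lemma le_pk (R : realType) (p : R) (k : nat) : 0 < p -> (2 <= k)%N ->
  (p <= pk k) =
  (k.+1%:R `^ (1 - 2 / p) * (k.+1%:R - 1) <= k%:R `^ (1 - 2 / p) * (k%:R - 1)).
Proof.
move=> p0 k2; rewrite /pk leqNgt k2 /=.
have kS : k.+1%:R - 1 = k%:R :> R by rewrite -natr1 addrK.
have k0 : 0 < k%:R :> R by rewrite ltr0n (ltn_trans _ k2).
have k1 : 0 < k%:R - 1 :> R by rewrite subr_gt0 ltr1n.
have kS0 : 0 < k.+1%:R :> R by rewrite ltr0n.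
have -> : 1 + k%:R^-1 = k.+1%:R / k%:R :> R.
  by rewrite -natr1; field; rewrite gt_eqF.
have -> : 1 + 2 / (k%:R - 1) = k.+1%:R / (k%:R - 1) :> R.
  by rewrite -natr1; field; rewrite gt_eqF.
rewrite ler_pdivlMr; last first.
  by rewrite ln_gt0// ltr_pdivlMr// mul1r -natr1; lra.
rewrite kS -[RHS]ler_ln ?posrE ?mulr_gt0 ?powR_gt0//.
rewrite !lnM ?posrE ?invr_gt0 ?powR_gt0// !ln_powR !lnV ?posrE//.
rewrite -[RHS](ler_pM2l p0) -[LHS]subr_ge0 -[RHS]subr_ge0; congr (0 <= _).
by field; rewrite gt_eqF.
Qed.

(** The sign is reversed so that, for [0 < p < 1], the derivative is a positive weight times an
    increasing affine factor, as [monotone_after_rise] wants. *)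
Lemma is_derive_tau_fun (R : realType) (p s : R) : 0 < s ->
  is_derive s 1 (fun s => (1 - s) * s `^ (1 - 2 / p))
    (s `^ (- (2 / p)) * ((2 / p - 2) * s - (2 / p - 1))).
Proof.
move=> s0.
have d1 : is_derive s 1 (fun s : R => 1 - s) (-1).
  by rewrite -[X in is_derive _ _ _ X]add0r; apply: is_deriveB.
have d2 := is_derive1_powR (1 - 2 / p) s0.
have d3 := is_deriveM d1 d2.
suff -> : s `^ (- (2 / p)) * ((2 / p - 2) * s - (2 / p - 1)) =
      (1 - s) *: ((1 - 2 / p) * s `^ (1 - 2 / p - 1)) +
          s `^ (1 - 2 / p) *: -1 by exact: d3.
rewrite /GRing.scale/=.
have -> : 1 - 2 / p - 1 = - (2 / p) by ring.
have -> : s `^ (1 - 2 / p) = s * s `^ (- (2 / p)).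
  by rewrite powRD ?powRr1 ?(ltW s0)// (gt_eqF s0) implybT.
by ring.
Qed.

(** Unimodality: [monotone_after_rise] applied to the negated function of a real variable. *)
Lemma tau_nat_rise (R : realType) (p : R) (i j l : nat) : 0 < p < 1 ->
  (0 < i)%N -> (i < j)%N -> (j <= l)%N ->
  j%:R `^ (1 - 2 / p) * (j%:R - 1) <= i%:R `^ (1 - 2 / p) * (i%:R - 1) ->
  l%:R `^ (1 - 2 / p) * (l%:R - 1) <= j%:R `^ (1 - 2 / p) * (j%:R - 1).
Proof.
move=> /andP[p0 p1] i0 ij jl.
have q1 : 1 < p^-1 by rewrite invf_gt1.
pose f (s : R) := (1 - s) * s `^ (1 - 2 / p).
pose w (s : R) := s `^ (- (2 / p)).
pose h (s : R) := (2 / p - 2) * s - (2 / p - 1).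
have fE s : s `^ (1 - 2 / p) * (s - 1) = - f s by rewrite /f; ring.
rewrite !fE !lerN2.
have df (s : R) : 0 < s -> is_derive s 1 f (w s * h s).
  exact: is_derive_tau_fun.
have i0' : 0 < i%:R :> R by rewrite ltr0n.
apply: (@monotone_after_rise _ f w h) => //.
- by rewrite ltr_nat.
- by rewrite ler_nat.
- apply: derivable_within_continuous => x; rewrite in_itv/= => /andP[ix _].
  by case: (df x (lt_le_trans i0' ix)).
- move=> y; rewrite in_itv/= => /andP[iy _]; apply: df.
  exact: lt_trans iy.
- move=> y; rewrite in_itv/= => /andP[iy _].
  by rewrite powR_gt0// (lt_trans i0').
- by move=> y z _ _ yz; rewrite /h lerD2r ler_wpM2l//; lra.
Qed.

(** Beyond [k], the step down given by [le_pk] is never reversed; before [k], the strict rise from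
    the predecessor to [k] excludes any earlier fall. *)
Lemma tau_nat_max (R : realType) (p : R) (k n : nat) : 0 < p < 1 ->
  (2 <= k)%N -> pk k.-1 < p <= pk k -> (0 < n)%N ->
  n%:R `^ (1 - 2 / p) * (n%:R - 1) <= k%:R `^ (1 - 2 / p) * (k%:R - 1).
Proof.
move=> p01 k2 /andP[pk1 pk2] n0; have /andP[p0 p1] := p01.
have k0 : (0 < k)%N by rewrite (ltn_trans _ k2).
have [kn|nk|->//] := ltngtP k n.
  move: pk2; rewrite le_pk// => h; apply: le_trans (h).
  exact: (@tau_nat_rise _ p k k.+1 n).
case: k k2 pk1 pk2 {k0} nk => // k; rewrite ltnS => k1 pk1 pk2.
rewrite ltnS => nk.
(* Here [k] is the predecessor. [le_pk] starts at index 2, so the value 1 is treated apart; it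
   forces [n = 1], with left side 0. *)
have [k1E|k_neq1] := eqVneq k 1%N.
  have -> : n = 1%N by move: nk n0; rewrite k1E; case: n => [|[]].
  by rewrite subrr mulr0 mulr_ge0 ?powR_ge0// subr_ge0 ler1n.
have {k_neq1}k2 : (2 <= k)%N by rewrite ltn_neqAle eq_sym k_neq1.
have kS : k%:R `^ (1 - 2 / p) * (k%:R - 1)
        < k.+1%:R `^ (1 - 2 / p) * (k.+1%:R - 1) :> R.
  by rewrite ltNge -le_pk// -ltNge.
move: nk; rewrite leq_eqVlt => /predU1P[->|nk]; first exact: ltW.
have [h|/ltW h] := leP (n%:R `^ (1 - 2 / p) * (n%:R - 1))
                  (k%:R `^ (1 - 2 / p) * (k%:R - 1) : R).
  exact: le_trans h (ltW kS).
by move: kS; rewrite ltNge (@tau_nat_rise _ p n k k.+1).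
Qed.

(** Take the least [k >= 2] with [p <= pk k]. If there were none, [le_pk] would make the values
    increase forever, whereas the function decreases past its critical point. *)
Lemma exists_pk_interval (R : realType) (p : R) : 0 < p < 1 ->
  exists k : nat, (2 <= k)%N /\ pk k.-1 < p <= pk k.
Proof.
move=> p01; have /andP[p0 p1] := p01.
have ex : exists k : nat, (2 <= k)%N && (p <= pk k).
  apply/not_existsP => nex.
  have incr (k : nat) : (2 <= k)%N -> k%:R `^ (1 - 2 / p) * (k%:R - 1)
        < k.+1%:R `^ (1 - 2 / p) * (k.+1%:R - 1) :> R.
    by move=> k2; rewrite ltNge -le_pk//; apply/negP => h; apply: (nex k); rewrite k2.
  have q1 : 1 < p^-1 by rewrite invf_gt1.
  have q0 : 0 < 2 / p - 2 by lra.
  (* An integer beyond the critical point and at least 2. *)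
  pose k := (Num.truncn ((2 / p - 1) / (2 / p - 2))).+2.
  have kq : (2 / p - 1) / (2 / p - 2) < k%:R.
    by rewrite (lt_le_trans (truncnS_gt _))// ler_nat.
  have k0 : 0 < k%:R :> R by rewrite ltr0n.
  have := incr k isT; rewrite ltNge => /negP; apply.
  have := @le_of_derive_ge0 R (fun s => (1 - s) * s `^ (1 - 2 / p))
    (fun s => s `^ (- (2 / p)) * ((2 / p - 2) * s - (2 / p - 1))) k%:R k.+1%:R.
  rewrite ler_nat leqnSn => /(_ isT) H.
  suff : (1 - k%:R) * k%:R `^ (1 - 2 / p) <=
         (1 - k.+1%:R) * k.+1%:R `^ (1 - 2 / p) :> R.
    by rewrite -lerN2 -!mulNr !opprB ![(_ - 1) * _]mulrC.
  apply: H => x; rewrite in_itv/= => /andP[kx _].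
    by apply: is_derive_tau_fun; exact: lt_le_trans kx.
  rewrite mulr_ge0 ?powR_ge0// subr_ge0 [leRHS]mulrC -ler_pdivrMr//.
  by rewrite ltW// (lt_trans kq).
case: (ex_minnP ex) => k /andP[k2 kp] kmin; exists k; split => //.
rewrite kp andbT.
(* Minimality gives the left inequality; for [k = 2] it is [0 < p], because [pk 1 = 0]. *)
case: k k2 kp kmin => [//|[//|[|k]]] _ _ kmin /=; first by rewrite /pk.
rewrite ltNge; apply/negP => h.
by have := kmin k.+2; rewrite h/= ltnn => /(_ isT).
Qed.

(** * The scale-invariant ratio *)

Lemma sum_le_size (R : realDomainType) (s : seq R) (f : R -> R) (c : R) :
  (forall x, x \in s -> f x <= c) -> \sum_(x <- s) f x <= (size s)%:R * c.
Proof.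
move=> fc; rewrite big_seq.
apply: (@le_trans _ _ (\sum_(x <- s | x \in s) c)); first exact: ler_sum.
by rewrite -big_seq big_const_seq count_predT iter_addr_0 mulr_natl.
Qed.

Lemma sum_ge_size (R : realDomainType) (s : seq R) (f : R -> R) (c : R) :
  (forall x, x \in s -> c <= f x) -> (size s)%:R * c <= \sum_(x <- s) f x.
Proof.
move=> fc; rewrite -lerN2 -sumrN -mulrN.
by apply: (@sum_le_size _ s (fun x => - f x)) => x xs; rewrite lerN2 fc.
Qed.

(** Superadditivity: [(a + b)^r = a (a + b)^(r-1) + b (a + b)^(r-1)], and each inner base is at
    least [a], respectively [b]. *)
Lemma sum_powR_le (R : realType) (r : R) (s : seq R) : 1 <= r ->
  all (fun t => 0 <= t) s -> \sum_(t <- s) t `^ r <= (\sum_(t <- s) t) `^ r.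
Proof.
move=> r1; have r0 : 0 < r by lra.
elim: s => [_|a s IHs /= /andP[a0 s0]]; first by rewrite !big_nil powR_ge0.
rewrite !big_cons; set b := \sum_(t <- s) t.
have b0 : 0 <= b.
  by rewrite /b big_seq; apply: sumr_ge0 => t; move/allP: s0; apply.
apply: (@le_trans _ _ (a `^ r + b `^ r)); first by rewrite lerD2l IHs.
have h : 0 <= r - 1 by lra.
rewrite -!(mulr_powRB1 _ r0) ?addr_ge0// mulrDl.
apply: lerD; apply: ler_wpM2l => //.
  by apply: ge0_ler_powR => //; rewrite ?nnegrE ?addr_ge0 ?lerDl.
by apply: ge0_ler_powR => //; rewrite ?nnegrE ?addr_ge0 ?lerDr.
Qed.

Lemma sum_norm_le_powR (R : realType) (p : R) (s : seq R) : 0 < p < 1 ->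
  \sum_(x <- s) `|x| <= (\sum_(x <- s) `|x| `^ p) `^ p^-1.
Proof.
move=> /andP[p0 p1].
have := @sum_powR_le R p^-1 [seq `|x| `^ p | x <- s].
rewrite !big_map => H; apply: le_trans (H _ _).
- under [leRHS]eq_bigr => x _ do rewrite -powRrM mulfV ?gt_eqF// powRr1//.
  by [].
- by rewrite ltW// invf_gt1.
- by apply/allP => _ /mapP[x _ ->]; exact: powR_ge0.
Qed.

Lemma sqr_sum_le_norm (R : realDomainType) (s : seq R) :
  (\sum_(x <- s) x) ^+ 2 <= (\sum_(x <- s) `|x|) ^+ 2.
Proof.
by rewrite -[leLHS]real_normK ?num_real// lerXn2r ?nnegrE ?ler_norm_sum// sumr_ge0.
Qed.

Lemma sum_sqr_le_norm (R : realDomainType) (s : seq R) :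
  \sum_(x <- s) x ^+ 2 <= (\sum_(x <- s) `|x|) ^+ 2.
Proof.
elim: s => [|a s IHs]; first by rewrite !big_nil expr0n.
rewrite !big_cons sqrrD real_normK ?num_real//.
have h : 0 <= `|a| * \sum_(j <- s) `|j| by rewrite mulr_ge0// sumr_ge0.
rewrite -addrA lerD2l (le_trans IHs)// lerDr mulrn_wge0//.
Qed.

(** The numerator is the sum of [x_i x_j] over [i != j]. At the zero vector, division by zero gives
    the value 0. *)
Definition pair_ratio (R : realType) (p : R) (x : seq R) : R :=
  ((\sum_(xi <- x) xi) ^+ 2 - \sum_(xi <- x) xi ^+ 2)
  / (\sum_(xi <- x) `|xi| `^ p) `^ (2 / p).

Lemma Zintegrand_pair_ratio (R : realType) (p beta : R) (x : seq R) :
  (0 < size x)%N -> Zintegrand p beta x =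
  expR (beta / 2 * (size x)%:R `^ (2 / p - 1) * pair_ratio p x).
Proof.
move=> x0; rewrite /Zintegrand /normnp /pair_ratio; congr expR.
set S := \sum_(xi <- x) `|xi| `^ p; set n : R := (size x)%:R.
have n0 : 0 < n by rewrite ltr0n.
have S0 : 0 <= S by apply: sumr_ge0 => t _; exact: powR_ge0.
have -> : ((n^-1 * S) `^ p^-1) ^+ 2 = (n `^ (2 / p))^-1 * S `^ (2 / p).
  rewrite -powR_mulrn ?powR_ge0// -powRrM [p^-1 * 2]mulrC powRM ?invr_ge0 ?(ltW n0)//.
  by rewrite -[n^-1]powR_inv1 ?(ltW n0)// -powRrM mulN1r powRN.
have -> : n `^ (2 / p - 1) = n `^ (2 / p) / n.
  by rewrite powRB ?powRr1 ?(ltW n0)// (gt_eqF n0) implybT.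
have nq : n `^ (2 / p) != 0 by rewrite gt_eqF// powR_gt0.
(* Keeping the inverse as an atom [T] lets [field] proceed even when [S = 0]. *)
rewrite invfM invrK; set T := (S `^ (2 / p))^-1.
by field; rewrite gt_eqF.
Qed.

(** This is [pair_sum_le] with [r = 1/p] and entries [|x_i|^p]; passing to absolute values keeps the
    squares and can only increase the squared sum. *)
Lemma pair_ratio_le (R : realType) (p M : R) (x : seq R) : 0 < p < 1 ->
  (forall n : nat, (0 < n)%N -> n%:R `^ (1 - 2 / p) * (n%:R - 1) <= M) ->
  pair_ratio p x <= M.
Proof.
move=> /andP[p0 p1] HM; rewrite /pair_ratio.
have M0 : 0 <= M by have := HM 1%N isT; rewrite subrr mulr0.
set S := \sum_(xi <- x) `|xi| `^ p.
have [->|S0] := eqVneq (S `^ (2 / p)) 0; first by rewrite invr0 mulr0.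
rewrite ler_pdivrMr; last by rewrite lt_neqAle eq_sym S0 powR_ge0.
have q1 : 1 < p^-1 by rewrite invf_gt1.
have y0 : all (fun t => 0 <= t) [seq `|t| `^ p | t <- x].
  by apply/allP => _ /mapP[t _ ->]; exact: powR_ge0.
have := pair_sum_le q1 HM y0; rewrite !big_map; apply: le_trans.
have pK (t : R) : (`|t| `^ p) `^ p^-1 = `|t|.
  by rewrite -powRrM mulfV ?gt_eqF// powRr1.
under eq_bigr do rewrite pK.
under [X in _ <= _ - X]eq_bigr do rewrite pK real_normK ?num_real//.
by rewrite lerD2r sqr_sum_le_norm.
Qed.

(** The entries of [s1] nearly equal [L], and those of [s2] have total absolute value at most [d L].
    Numerator and denominator are bounded separately, and the factor [L^2] cancels. *)
Lemma pair_ratio_ge (R : realType) (p L d : R) (s1 s2 : seq R) (k : nat) :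
  0 < p < 1 -> 0 < L -> 0 < d < 1 -> size s1 = k -> (0 < k)%N ->
  all (fun x => L <= x <= (1 + d) * L) s1 ->
  \sum_(x <- s2) `|x| `^ p <= d * L `^ p ->
  0 <= (k%:R - d) ^+ 2 - k%:R * (1 + d) ^+ 2 - d ^+ 2 ->
  ((k%:R - d) ^+ 2 - k%:R * (1 + d) ^+ 2 - d ^+ 2)
   / (k%:R * (1 + d) + d) `^ (2 / p) <= pair_ratio p (s1 ++ s2).
Proof.
move=> p01 L0 /andP[d0 d1] sk k0 hs1 hs2; have /andP[p0 p1] := p01.
set N := (X in 0 <= X -> _) => N0.
rewrite /pair_ratio !big_cat/=.
set A := \sum_(i <- s1) i; set B := \sum_(i <- s2) i.
set QA := \sum_(i <- s1) i ^+ 2; set QB := \sum_(i <- s2) i ^+ 2.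
set SA := \sum_(i <- s1) _; set SB := \sum_(i <- s2) _ in hs2 *.
have k1 : 1 <= k%:R :> R by rewrite ler1n.
have Lp0 : 0 < L `^ p by rewrite powR_gt0.
have hA : k%:R * L <= A.
  by rewrite -sk; apply: (@sum_ge_size _ s1 id) => x /(allP hs1)/andP[].
have hQA : QA <= k%:R * ((1 + d) * L) ^+ 2.
  rewrite -sk; apply: (@sum_le_size _ s1 (fun x => x ^+ 2)) => x /(allP hs1)/andP[Lx xL].
  by rewrite lerXn2r ?nnegrE//; lra.
have hSA : SA <= k%:R * ((1 + d) * L `^ p).
  rewrite -sk; apply: (@sum_le_size _ s1 (fun x => `|x| `^ p)) => x.
  move=> /(allP hs1)/andP[Lx xL].
  apply: (@le_trans _ _ (((1 + d) * L) `^ p)).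
    rewrite ger0_norm; last lra.
    by apply: ge0_ler_powR; rewrite ?nnegrE; lra.
  rewrite powRM; [|lra..].
  by rewrite ler_pM2r//; apply: ler1_powR; lra.
have hSA' : k%:R * L `^ p <= SA.
  rewrite -sk; apply: (@sum_ge_size _ s1 (fun x => `|x| `^ p)) => x.
  move=> /(allP hs1)/andP[Lx _]; rewrite ger0_norm; last lra.
  by apply: ge0_ler_powR; rewrite ?nnegrE; lra.
(* For [p < 1] the l1 norm is at most the lp quasi-norm, and [d^(1/p) <= d]. *)
have hB : \sum_(x <- s2) `|x| <= d * L.
  apply: le_trans (sum_norm_le_powR s2 p01) _.
  have SB0 : 0 <= SB by apply: sumr_ge0 => ? _; exact: powR_ge0.
  apply: (@le_trans _ _ ((d * L `^ p) `^ p^-1)).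
    apply: ge0_ler_powR; rewrite ?nnegrE ?invr_ge0 ?(ltW p0)//.
    by rewrite mulr_ge0 ?powR_ge0// ltW.
  rewrite powRM ?powR_ge0 ?(ltW d0)// -powRrM mulfV ?gt_eqF// powRr1 ?(ltW L0)//.
  rewrite ler_pM2r//; apply: ge1r_powR; first by rewrite d0 ltW.
  by rewrite ltW// invf_gt1.
have hB' : - (d * L) <= B.
  have : `|B| <= d * L := le_trans (ler_norm_sum _ _ _) hB.
  by rewrite ler_norml => /andP[].
have hQB : QB <= (d * L) ^+ 2.
  apply: le_trans (sum_sqr_le_norm _) _.
  by rewrite lerXn2r ?nnegrE// ?sumr_ge0// mulr_ge0 ?ltW.
have hnum : N * L ^+ 2 <= (A + B) ^+ 2 - (QA + QB).
  have : ((k%:R - d) * L) ^+ 2 <= (A + B) ^+ 2.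
    have h1 : (k%:R - d) * L <= A + B by lra.
    have h2 : 0 <= (k%:R - d) * L by rewrite mulr_ge0 ?(ltW L0)//; lra.
    by rewrite lerXn2r ?nnegrE// (le_trans h2).
  rewrite /N; move: hQA hQB; rewrite !exprMn; lra.
have hden : (SA + SB) `^ (2 / p) <= (k%:R * (1 + d) + d) `^ (2 / p) * L ^+ 2.
  have -> : L ^+ 2 = (L `^ p) `^ (2 / p).
    rewrite -powRrM mulrCA mulfV ?gt_eqF// mulr1 powR_mulrn ?ltW//.
  have D0 : 0 <= k%:R * (1 + d) + d by rewrite addr_ge0 ?mulr_ge0; lra.
  have SB0 : 0 <= SB by apply: sumr_ge0 => ? _; exact: powR_ge0.
  have SA0 : 0 <= SA by apply: sumr_ge0 => ? _; exact: powR_ge0.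
  rewrite -powRM ?powR_ge0//; apply: ge0_ler_powR; rewrite ?nnegrE ?addr_ge0//.
  - by rewrite divr_ge0// ltW.
  - by rewrite mulr_ge0 ?powR_ge0.
  - by rewrite mulrDl -mulrA lerD.
have S0 : 0 < (SA + SB) `^ (2 / p).
  have SB0 : 0 <= SB by apply: sumr_ge0 => ? _; exact: powR_ge0.
  rewrite powR_gt0// ltr_pwDl// (lt_le_trans _ hSA')// mulr_gt0//; lra.
have D0 : 0 < (k%:R * (1 + d) + d) `^ (2 / p).
  by rewrite powR_gt0// addr_gt0// mulr_gt0//; lra.
rewrite ler_pdivlMr// mulrAC ler_pdivrMr//.
apply: (@le_trans _ _ (N * ((k%:R * (1 + d) + d) `^ (2 / p) * L ^+ 2))).
  by rewrite ler_wpM2l.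
by rewrite mulrCA mulrC ler_pM2r.
Qed.

(* An integral is a difference of two suprema over simple functions, each
   monotone in the integrand, measurable or not. *)
Lemma le_integral_pointwise d (T : measurableType d) (R : realType)
    (mu : {measure set T -> \bar R}) (f g : T -> \bar R) :
  (forall x, (f x <= g x)%E) -> (\int[mu]_x f x <= \int[mu]_x g x)%E.
Proof.
move=> fg; rewrite /integral !patch_setT; apply: leeB.
  apply: le_ereal_sup => _ [h /= hf <-]; exists h => //= x.
  apply: le_trans (hf x) _; rewrite !funeposE.
  by rewrite ge_max !le_max lexx fg orbT.
apply: le_ereal_sup => _ [h /= hg <-]; exists h => //= x.
apply: le_trans (hg x) _; rewrite !funenegE.
by rewrite ge_max !le_max lexx leeN2 fg orbT.
Qed.

(** * The iterated integral *)

Section IterInt.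
Variables (R : realType) (rho : probability R R).

Lemma iter_int_le n (F G : seq R -> \bar R) :
  (forall s, size s = n -> (F s <= G s)%E) ->
  (iter_int rho n F <= iter_int rho n G)%E.
Proof.
elim: n F G => [|n IHn] F G FG /=; first exact: FG.
by apply: le_integral_pointwise => x; apply: IHn => s sn; apply: FG; rewrite /= sn.
Qed.

Lemma iter_int_cst n (c : R) : iter_int rho n (fun=> c%:E) = c%:E.
Proof.
elim: n => //= n ->; etransitivity; first exact: (@integral_cst _ _ _ rho setT measurableT c%:E).
by rewrite [X in (_ * X)%E](probability_setT rho) mule1.
Qed.

(** Each coordinate subtracts its mean [m / M]. The constant [c] is general because the induction
    absorbs the first coordinate into it. *)
Lemma iter_int_markov n (p M c m : R) :
  (\int[rho]_x (`|x| `^ p)%:E = m%:E)%E ->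
  iter_int rho n (fun s => (c - (\sum_(x <- s) `|x| `^ p) / M)%:E)
    = (c - n%:R * m / M)%:E.
Proof.
move=> mE; have mf : measurable_fun setT (fun x : R => `|x| `^ p).
  exact: (@measurableT_comp _ _ _ _ _ _ (@powR R ^~ p)).
have fi : rho.-integrable setT (EFin \o (fun x : R => `|x| `^ p)).
  apply/integrableP; split; first exact/measurable_EFinP.
  rewrite (eq_integral (fun x : R => (`|x| `^ p)%:E)) ?mE ?ltry// => x _.
  by rewrite /= ger0_norm// powR_ge0.
have ci (a : R) : rho.-integrable setT (EFin \o cst a).
  by apply: finite_measure_integrable_cst.
have fMi : rho.-integrable setT (EFin \o (fun x : R => M^-1 * `|x| `^ p)).
  exact: (integrableZl measurableT M^-1 fi).
elim: n c => [|n IHn] c /=; first by rewrite big_nil !mul0r.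
rewrite (eq_integral (fun x : R => ((c - n%:R * m / M)%:E - (M^-1 * `|x| `^ p)%:E)%E)); last first.
  move=> x _; rewrite -EFinB.
  have -> : c - n%:R * m / M - M^-1 * `|x| `^ p = (c - M^-1 * `|x| `^ p) - n%:R * m / M by ring.
  rewrite -IHn; congr (iter_int rho n _); apply/funext => s.
  by rewrite big_cons; congr EFin; ring.
rewrite (integralB_EFin measurableT (ci _) fMi).
rewrite (_ : \int[rho]_x (c - n%:R * m / M)%:E = (c - n%:R * m / M)%:E)%E; last first.
  exact: (iter_int_cst 1).
rewrite [X in (_ - X)%E](_ : _ = (M^-1 * m)%:E); last first.
  rewrite EFinM -mE -integralZl//.
by rewrite -EFinB; congr EFin; rewrite -natr1; ring.
Qed.

(** Each of the first [n] coordinates contributes a factor [rho A]: on [A] the induction bounds the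
    inner integral, and off [A] it is at least 0. *)
Lemma iter_int_cat_ge n m (A : set R) (v : R) (F : seq R -> \bar R) :
  measurable A -> 0 <= v -> (forall s, (0 <= F s)%E) ->
  (forall s, size s = n -> (forall x, x \in s -> A x) ->
     (v%:E <= iter_int rho m (fun s' => F (s ++ s')))%E) ->
  ((fine (rho A) ^+ n * v)%:E <= iter_int rho (n + m) F)%E.
Proof.
move=> mA v0; have rE : rho A = (fine (rho A))%:E by rewrite fineK// fin_num_measure.
have rA0 : 0 <= fine (rho A) by rewrite fine_ge0.
set a := fine (rho A) in rE rA0 *.
elim: n F => [|n IHn] F F0 H.
  by rewrite expr0 mul1r; exact: (H [::]).
rewrite addSn /=.
have G0 k (G : seq R -> \bar R) : (forall s, (0 <= G s)%E) -> (0 <= iter_int rho k G)%E.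
  move=> G0; have := @iter_int_le k (fun=> 0%:E) G (fun s _ => G0 s).
  by rewrite iter_int_cst.
apply: (@le_trans _ _ (\int[rho]_x ((a ^+ n * v)%:E * (\1_A x)%:E))%E).
  rewrite ge0_integralZl_EFin//; last 2 first.
  - exact/measurable_EFinP.
  - by rewrite mulr_ge0 ?exprn_ge0.
  rewrite integral_indic// setIT [X in (_ * X)%E]rE.
  by rewrite -EFinM lee_fin exprS -mulrA mulrC.
apply: le_integral_pointwise => x.
rewrite indicE; case: (boolP (x \in A)) => [|_]; last first.
  by rewrite mule0; apply: G0 => s.
rewrite inE mule1 => Ax; apply: IHn => // s sn sA.
have := H (x :: s); rewrite /= sn; apply => // y.
by rewrite inE => /predU1P[->//|/sA].
Qed.

End IterInt.

(** * Limits of powers, and a shell of positive mass *)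

Lemma near_powR_ge (R : realType) (e M : R) : 0 < e ->
  \forall n \near \oo, M <= n%:R `^ e.
Proof.
move=> e0; pose M0 := Num.max M 0.
have M00 : 0 <= M0 by rewrite le_max lexx orbT.
near=> n; apply: (@le_trans _ _ M0); first by rewrite le_max lexx.
have -> : M0 = (M0 `^ e^-1) `^ e by rewrite -powRrM mulVf ?gt_eqF// powRr1.
apply: ge0_ler_powR; rewrite ?nnegrE ?powR_ge0 ?(ltW e0)//.
by near: n; exact: nbhs_infty_ger.
Unshelve. all: by end_near. Qed.

Lemma cvg_powR_lt0 (R : realType) (e : R) : e < 0 ->
  (fun n : nat => n%:R `^ e : R) @ \oo --> (0 : R).
Proof.
move=> e0; apply/cvgrPdist_le => eps eps0; near=> n.
rewrite sub0r normrN ger0_norm ?powR_ge0// -[e]opprK powRN.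
have h : eps^-1 <= n%:R `^ (- e).
  by near: n; apply: near_powR_ge; rewrite oppr_gt0.
rewrite -[eps]invrK lef_pV2// ?posrE ?invr_gt0//.
by rewrite (lt_le_trans _ h)// invr_gt0.
Unshelve. all: by end_near. Qed.

(** At [d = 0] the quotient equals [k^(1 - 2/p) (k - 1)]; continuity gives the bound for small
    positive [d]. *)
Lemma exists_small_spread (R : realType) (p e : R) (k : nat) :
  0 < p < 1 -> (2 <= k)%N -> 0 < e ->
  exists d : R, [/\ 0 < d < 1,
    0 <= (k%:R - d) ^+ 2 - k%:R * (1 + d) ^+ 2 - d ^+ 2 &
    k%:R `^ (1 - 2 / p) * (k%:R - 1) - e <=
    ((k%:R - d) ^+ 2 - k%:R * (1 + d) ^+ 2 - d ^+ 2)
      / (k%:R * (1 + d) + d) `^ (2 / p)].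
Proof.
move=> /andP[p0 p1] k2 e0.
have k1 : 1 < k%:R :> R by rewrite ltr1n.
pose N (d : R) := (k%:R - d) ^+ 2 - k%:R * (1 + d) ^+ 2 - d ^+ 2.
pose D (d : R) := `|k%:R * (1 + d) + d| `^ (2 / p).
have cid : (fun d : R => d) @ (0 : R) --> (0 : R) by exact: cvg_id.
have c1d : (fun d : R => 1 + d) @ (0 : R) --> (1 + 0 : R).
  by apply: cvgD => //; exact: cvg_cst.
have ckd : (fun d : R => k%:R - d) @ (0 : R) --> (k%:R - 0 : R).
  by apply: cvgB => //; exact: cvg_cst.
have cN : N @ (0 : R) --> N 0.
  apply: cvgB; last by apply: cvgM.
  apply: cvgB; first by apply: cvgM.
  by apply: cvgM; [exact: cvg_cst|apply: cvgM].
have cD : D @ (0 : R) --> D 0.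
  apply: (@continuous_comp R^o R^o R^o (fun d => k%:R * (1 + d) + d)
    (fun v => `|v| `^ (2 / p))).
    by apply: cvgD => //; apply: cvgM => //; exact: cvg_cst.
  by apply: continuous_powR_norm; rewrite divr_gt0.
have k0 : 0 < k%:R :> R by lra.
have D0E : D 0 = k%:R `^ (2 / p) by rewrite /D !addr0 mulr1 ger0_norm// ltW.
have D0 : 0 < D 0 by rewrite D0E powR_gt0.
have cR : (fun d => N d / D d) @ (0 : R) --> N 0 / D 0.
  by apply: cvgM => //; apply: cvgV => //; rewrite gt_eqF.
have N0 : N 0 = k%:R * (k%:R - 1) by rewrite /N; ring.
have RE : N 0 / D 0 = k%:R `^ (1 - 2 / p) * (k%:R - 1).
  rewrite N0 D0E powRB ?powRr1 ?(ltW k0) ?(gt_eqF k0) ?implybT//.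
  by rewrite mulrAC.
have nN : \forall d \near (0 : R)^'+, 0 <= N d.
  near=> d; apply: ltW; near: d.
  apply: (cvgr_gt _ (cvg_at_right_filter cN)).
  by rewrite N0 mulr_gt0//; lra.
have nR : \forall d \near (0 : R)^'+, N 0 / D 0 - e <= N d / D d.
  near=> d; apply: ltW; near: d.
  by apply: (cvgr_gt _ (cvg_at_right_filter cR)); lra.
have nd : \forall d \near (0 : R)^'+, 0 < d < 1.
  near=> d; apply/andP; split; near: d; [exact: nbhs_right_gt|exact: nbhs_right_lt].
have [d [[d01 Nd] Rd]] := filter_ex (filterI (filterI nd nN) nR).
exists d; split => //; move: Rd; rewrite RE /D ger0_norm//.
have /andP[d0 d1] := d01.
by rewrite addr_ge0 ?mulr_ge0//; lra.
Unshelve. all: by end_near. Qed.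

(** The shells with positive rational left end are countably many and cover the positive half-line.
    If all were null, so would be that half-line, its mirror image by symmetry and, with the null
    set [{0}], the whole line. *)
Lemma exists_charged_shell (R : realType) (rho : probability R R) (t : R) :
  (forall A : set R, measurable A -> rho ((fun x => - x) @^-1` A) = rho A) ->
  rho [set 0] = 0%E -> 1 < t ->
  exists2 a : R, 0 < a & (0 < rho [set y : R | (a <= y <= t * a)%R])%E.
Proof.
move=> sym r0 t1; apply: contrapT => /forall2NP nex.
pose F (i : nat) : set R := match unpickle i with
  | Some q => if 0 < ratr (q : rat) :> R
              then [set y : R | ratr q <= y <= t * ratr q] else set0
  | None => set0 end.
have negF i : rho.-negligible (F i).
  rewrite /F; case: (unpickle i) => [q|]; last exact: negligible_set0.
  case: ifPn => q0; last exact: negligible_set0.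
  have [//|/negP] := nex (ratr q); rewrite lt0e measure_ge0 andbT negbK => /eqP h.
  have mS : measurable [set y : R | ratr q <= y <= t * ratr q].
    by rewrite -set_itvcc.
  exact/negligibleP.
have negP : rho.-negligible [set y : R | 0 < y].
  apply: negligibleS (negligible_bigcup negF) => y /= y0.
  have yt : y / t < y by rewrite ltr_pdivrMr ?ltr_pMr//; lra.
  (* A rational [q] between [y / t] and [y] has [y] in its shell. *)
  have [q] := rat_in_itvoo yt; rewrite in_itv/= => /andP[q1 q2].
  exists (pickle q); first exact: I.
  rewrite /F pickleK.
  have -> : 0 < ratr q :> R by rewrite (lt_trans _ q1)// divr_gt0//; lra.
  by rewrite /= (ltW q2)/= mulrC -ler_pdivrMr ?(ltW q1)//; lra.
have mP : measurable [set y : R | 0 < y] by rewrite -set_itvoy.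
have negN : rho.-negligible [set y : R | y < 0].
  have mN : measurable [set y : R | y < 0] by rewrite -set_itvNyo.
  apply/negligibleP => //.
  rewrite -[RHS](proj1 (negligibleP rho mP) negP) -[RHS](sym _ mP).
  by congr (rho _); apply/seteqP; split => y /=; rewrite oppr_gt0.
have neg0 : rho.-negligible [set (0 : R)] by apply/negligibleP.
have negT : rho.-negligible [set: R].
  apply: negligibleS (negligibleU (negligibleU negP negN) neg0) => y _ /=.
  by case: (ltgtP y 0) => [?|?|->]; [left; right|left; left|right].
have := proj1 (negligibleP rho measurableT) negT.
by rewrite [LHS](probability_setT rho) => -[/eqP]; rewrite oner_eq0.
Qed.

(** * Bounds on the partition function *)

Section LogPartition.
Variables (R : realType) (rho : probability R R) (p : R).
Hypothesis p01 : 0 < p < 1.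

Lemma Znp_le (n : nat) (beta M : R) : (0 < n)%N -> 0 < beta ->
  (forall j : nat, (0 < j)%N -> j%:R `^ (1 - 2 / p) * (j%:R - 1) <= M) ->
  (Znp n p beta rho <= (expR (beta / 2 * n%:R `^ (2 / p - 1) * M))%:E)%E.
Proof.
move=> n0 b0 HM; rewrite -[leRHS](iter_int_cst rho n).
apply: iter_int_le => s sn; rewrite Zintegrand_pair_ratio ?sn// lee_fin ler_expR.
apply: ler_wpM2l; last exact: pair_ratio_le.
by rewrite mulr_ge0 ?powR_ge0// divr_ge0// ltW.
Qed.

(** On the event that [k] coordinates lie in the shell and the tail is small, [pair_ratio_ge] bounds
    the integrand below by [c]. The tail event is a Boolean cast to a number, and [w] is any lower
    bound on its integral weighted by [c]. *)
Lemma Znp_ge (k m : nat) (beta L d w : R) :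
  (0 < k)%N -> 0 < beta -> 0 < L -> 0 < d < 1 ->
  let N := (k%:R - d) ^+ 2 - k%:R * (1 + d) ^+ 2 - d ^+ 2 in
  let c := expR (beta / 2 * (k + m)%:R `^ (2 / p - 1) *
                 (N / (k%:R * (1 + d) + d) `^ (2 / p))) in
  0 <= N -> 0 <= w ->
  (w%:E <= iter_int rho m
     (fun s => ((\sum_(x <- s) `|x| `^ p <= d * L `^ p)%R%:R * c)%:E))%E ->
  ((fine (rho [set y : R | L <= y <= (1 + d) * L]) ^+ k * w)%:E
     <= Znp (k + m) p beta rho)%E.
Proof.
move=> k0 b0 L0 d01 N c N0 w0 wle; apply: iter_int_cat_ge => //.
- by rewrite -set_itvcc.
- by move=> s; rewrite lee_fin expR_ge0.
move=> s sk sL; apply: le_trans wle _; apply: iter_int_le => s' sm.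
rewrite lee_fin; have [h|_] := leP (\sum_(x <- s') `|x| `^ p) (d * L `^ p); last first.
  by rewrite mul0r expR_ge0.
rewrite mul1r Zintegrand_pair_ratio size_cat sk sm ?addn_gt0 ?k0// ler_expR.
apply: ler_wpM2l; first by rewrite mulr_ge0 ?powR_ge0// divr_ge0// ltW.
by apply: (@pair_ratio_ge _ p L) => //; apply/allP => x /sL.
Qed.

(** Markov's inequality: the weighted indicator dominates [c - c S / M], whose iterated integral is
    at least [c / 2]. *)
Lemma iter_int_tail_markov (m : nat) (M c mu : R) :
  (\int[rho]_x (`|x| `^ p)%:E = mu%:E)%E -> 0 < M -> 0 < c ->
  2 * (m%:R * mu) <= M ->
  ((c / 2)%:E <= iter_int rho m
     (fun s => ((\sum_(x <- s) `|x| `^ p <= M)%R%:R * c)%:E))%E.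
Proof.
move=> muE M0 c0 hM.
apply: (@le_trans _ _ (c - m%:R * mu / (M / c))%:E).
  rewrite lee_fin invf_div lerBrDr -lerBrDl mulrA ler_pdivrMr//.
  have -> : (c - c / 2) * M = c * (M / 2) by field.
  by rewrite mulrC ler_pM2l// ler_pdivlMr// mulrC.
rewrite -(iter_int_markov m (M / c) c muE).
apply: iter_int_le => s _; rewrite lee_fin invf_div.
set S := \sum_(x <- s) _.
have S0 : 0 <= S by apply: sumr_ge0 => ? _; exact: powR_ge0.
have [SM|MS] := leP S M.
  by rewrite mul1r gerBl// mulr_ge0// divr_ge0// ltW.
by rewrite mul0r subr_le0 mulrA ler_pdivlMr// mulrC ler_pM2r// ltW.
Qed.

Lemma iter_int_tail_small (m : nat) (M c eta : R) : 0 <= c ->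
  m%:R * eta `^ p <= M ->
  ((fine (rho [set y : R | `|y| < eta]) ^+ m * c)%:E <= iter_int rho m
     (fun s => ((\sum_(x <- s) `|x| `^ p <= M)%R%:R * c)%:E))%E.
Proof.
move=> c0 hM; have /andP[p0 _] := p01; rewrite -[in leRHS](addn0 m).
(* All [m] coordinates are confined to the interval, the remaining block being empty. *)
apply: iter_int_cat_ge => //.
- rewrite (_ : [set y | _] = `]- eta, eta[%classic); last first.
    by apply/seteqP; split => y /=; rewrite in_itv/= ltr_norml.
  exact: measurable_itv.
- by move=> s; rewrite lee_fin mulr_ge0.
move=> s sm sB /=; rewrite cats0 lee_fin.
suff -> : \sum_(x <- s) `|x| `^ p <= M by rewrite mul1r.
apply: le_trans hM; rewrite -sm.
apply: (@sum_le_size _ s (fun x => `|x| `^ p)) => x /sB /= /ltW xe.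
by apply: ge0_ler_powR; rewrite ?nnegrE ?(ltW p0)// (le_trans _ xe).
Qed.

Lemma scaled_ln_Znp_bounds (n : nat) (beta psi M w : R) : (0 < n)%N -> 0 < w ->
  ((w * expR (beta / 2 * n%:R `^ (2 / p - 1) * psi))%:E
     <= Znp n p beta rho)%E ->
  (Znp n p beta rho <= (expR (beta / 2 * n%:R `^ (2 / p - 1) * M))%:E)%E ->
  beta / 2 * psi + n%:R `^ (1 - 2 / p) * ln w
    <= n%:R `^ (1 - 2 / p) * ln (fine (Znp n p beta rho)) <= beta / 2 * M.
Proof.
(* The two bounds exclude infinite values, so [fine] returns the true value. *)
move=> n0 w0; case: (Znp n p beta rho) => // z; rewrite !lee_fin /= => wz zM.
have nn0 : 0 < n%:R :> R by rewrite ltr0n.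
have nK (c u : R) : n%:R `^ (1 - 2 / p) * (c * n%:R `^ (2 / p - 1) * u) = c * u.
  rewrite mulrAC mulrCA -powRD; last by rewrite (gt_eqF nn0) implybT.
  by rewrite addrA subrK subrr powRr0 mulr1.
have w1 : 0 < w * expR (beta / 2 * n%:R `^ (2 / p - 1) * psi).
  by rewrite mulr_gt0 ?expR_gt0.
have z0 : 0 < z := lt_le_trans w1 wz.
rewrite -ler_ln ?posrE// lnM ?posrE ?expR_gt0// expRK in wz.
rewrite -ler_ln ?posrE ?expR_gt0// expRK in zM.
apply/andP; split.
  rewrite -[beta / 2 * psi]nK -mulrDr ler_wpM2l ?powR_ge0//.
  by rewrite addrC.
by rewrite -[beta / 2 * M]nK ler_wpM2l ?powR_ge0.
Qed.

End LogPartition.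

Lemma near_mul_powR_le (R : realType) (K e eps : R) : e < 0 -> 0 < eps ->
  \forall n \near \oo, K * n%:R `^ e <= eps.
Proof.
move=> e0 eps0.
have h : (fun n : nat => K * n%:R `^ e) @ \oo --> K * 0.
  by apply: cvgM; [exact: cvg_cst|exact: cvg_powR_lt0].
by near=> n; apply: ltW; near: n; apply: (cvgr_lt _ h); rewrite mulr0.
Unshelve. all: by end_near. Qed.

(** * Cost of the configurations that give the lower bound *)

Section LowerBound.
Variables (R : realType) (rho : probability R R) (p beta d : R) (k : nat).
Hypotheses (p01 : 0 < p < 1) (beta0 : 0 < beta) (d01 : 0 < d < 1) (k0 : (0 < k)%N).
Let N := (k%:R - d) ^+ 2 - k%:R * (1 + d) ^+ 2 - d ^+ 2.
Let psi := N / (k%:R * (1 + d) + d) `^ (2 / p).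
Hypothesis N0 : 0 <= N.

(* Large values: [k] coordinates of size [L], of order [n^(1/p)], dominate the
   others, whose [p]-th moment sum is of order [n]. *)
Lemma near_weight_large_values (C a1 : R) :
  (\int[rho]_x (`|x| `^ p)%:E < +oo)%E -> a1 < 2 - p ->
  (\forall x \near +oo,
      (0 < rho [set y : R | (x <= y <= (1 + d) * x)%R])%E /\
      `|ln (fine (rho [set y : R | (x <= y <= (1 + d) * x)%R]))| <= C * x `^ a1) ->
  forall eps : R, 0 < eps -> \forall n \near \oo, exists w : R,
    [/\ 0 < w,
        ((w * expR (beta / 2 * n%:R `^ (2 / p - 1) * psi))%:E
           <= Znp n p beta rho)%E &
        - eps <= n%:R `^ (1 - 2 / p) * ln w].
Proof.
move=> mom a1p [x0 [_ hx0]] eps eps0.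
have /andP[p0 p1] := p01; have /andP[d0 d1] := d01.
have [mu muE mu0] : exists2 mu : R, (\int[rho]_x (`|x| `^ p)%:E = mu%:E)%E & 0 <= mu.
  have I0 : (0 <= \int[rho]_x (`|x| `^ p)%:E)%E.
    by apply: integral_ge0 => x _; rewrite lee_fin powR_ge0.
  exists (fine (\int[rho]_x (`|x| `^ p)%:E)); last exact: fine_ge0.
  by rewrite fineK// ge0_fin_numE.
(* With [L^p = kap * n], the tail threshold [d * L^p] is [2 (mu + 1) n], enough for Markov's
   inequality; the added 1 keeps [kap] positive. *)
pose kap := 2 * (mu + 1) / d; pose kq := kap `^ p^-1.
have kap0 : 0 < kap by rewrite divr_gt0// mulr_gt0//; lra.
have kq0 : 0 < kq by rewrite powR_gt0.
have q1 : 1 < p^-1 by rewrite invf_gt1.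
have e10 : 1 - 2 / p < 0 by lra.
(* The shell costs [L^a1], of order [n^(a1/p)]; this is below [n^(2/p - 1)] exactly when
   [a1 < 2 - p]. *)
have e20 : 1 - 2 / p + p^-1 * a1 < 0.
  have -> : 1 - 2 / p + p^-1 * a1 = (a1 - (2 - p)) * p^-1.
    by field; rewrite gt_eqF.
  by rewrite nmulr_rlt0 ?invr_gt0// subr_lt0.
near=> n.
have kn : (k <= n)%N by near: n; exact: nbhs_infty_ge.
have n0 : (0 < n)%N by apply: leq_trans kn.
have nn0 : 0 < n%:R :> R by rewrite ltr0n.
pose L := kq * n%:R `^ p^-1.
have L0 : 0 < L by rewrite mulr_gt0// powR_gt0.
have Lp : L `^ p = kap * n%:R.
  rewrite powRM ?powR_ge0 ?(ltW kq0)// -!powRrM mulVf ?(gt_eqF p0)//.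
  by rewrite !powRr1 ?(ltW kap0) ?(ltW nn0).
have La : L `^ a1 = kq `^ a1 * n%:R `^ (p^-1 * a1).
  by rewrite powRM ?powR_ge0 ?(ltW kq0)// -powRrM.
have xL : x0 < L.
  have : (x0 + 1) / kq <= n%:R `^ p^-1.
    by near: n; apply: near_powR_ge; rewrite invr_gt0.
  by rewrite ler_pdivrMr// mulrC -/L; lra.
have [rA lnA] := hx0 L xL.
set A := [set y : R | L <= y <= (1 + d) * L] in rA lnA.
have fA : rho A \is a fin_num.
  by apply: fin_num_measure; rewrite /A -set_itvcc.
have rA0 : 0 < fine (rho A) by rewrite fine_gt0// rA -ge0_fin_numE.
(* The factor one half comes from Markov's inequality. *)
exists (fine (rho A) ^+ k * 2^-1); split.
- by rewrite mulr_gt0 ?exprn_gt0// invr_gt0.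
- set c := expR _.
  rewrite -mulrA [2^-1 * c]mulrC -(subnKC kn).
  apply: (@Znp_ge _ _ _ p01 k (n - k) beta L d) => //.
    by rewrite divr_ge0 ?expR_ge0.
  rewrite subnKC// -/N -/psi -/c.
  apply: (@iter_int_tail_markov _ _ _ (n - k) (d * L `^ p) c mu) => //.
  + by rewrite mulr_gt0// powR_gt0.
  + exact: expR_gt0.
  have -> : d * L `^ p = 2 * ((mu + 1) * n%:R).
    by rewrite Lp /kap; field; rewrite gt_eqF.
  rewrite ler_pM2l// mulrC; apply: ler_pM => //; first lra.
  by rewrite ler_nat leq_subr.
- rewrite lnM ?posrE ?exprn_gt0 ?invr_gt0// lnXn// lnV ?posrE//.
  have h1 : k%:R * (C * kq `^ a1) * n%:R `^ (1 - 2 / p + p^-1 * a1) <= eps / 2.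
    by near: n; apply: near_mul_powR_le => //; rewrite divr_gt0.
  have h2 : ln 2 * n%:R `^ (1 - 2 / p) <= eps / 2.
    by near: n; apply: near_mul_powR_le => //; rewrite divr_gt0.
  have h3 : - (C * L `^ a1) <= ln (fine (rho A)).
    by move: lnA; rewrite ler_norml => /andP[].
  have h4 : k%:R * - (C * L `^ a1) <= k%:R * ln (fine (rho A)) by rewrite ler_wpM2l.
  rewrite -[ln _ *+ k]mulr_natl.
  apply: (@le_trans _ _ (n%:R `^ (1 - 2 / p) * (k%:R * - (C * L `^ a1) - ln 2))).
    rewrite La; move: h1; rewrite powRD; last by rewrite (gt_eqF nn0) implybT.
    set X := n%:R `^ (1 - 2 / p) in h2 *; set Y := n%:R `^ (p^-1 * a1).
    have -> : X * (k%:R * - (C * (kq `^ a1 * Y)) - ln 2) =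
      - (k%:R * (C * kq `^ a1) * (X * Y)) - ln 2 * X by ring.
    by move=> h1; lra.
  by rewrite ler_wpM2l ?powR_ge0// lerD2r.
Unshelve. all: by end_near. Qed.

(* Small values: [k] coordinates of size [a] are kept fixed, and the others are
   forced down to order [n^(-1/p)]. *)
Lemma near_weight_small_values (C a2 a : R) :
  0 < a -> (0 < rho [set y : R | (a <= y <= (1 + d) * a)%R])%E ->
  a2 < 2 * (1 - p) ->
  (\forall x \near 0^'+,
      (0 < rho [set y : R | (`|y| < x)%R])%E /\
      `|ln (fine (rho [set y : R | (`|y| < x)%R]))| <= C * x `^ (- a2)) ->
  forall eps : R, 0 < eps -> \forall n \near \oo, exists w : R,
    [/\ 0 < w,
        ((w * expR (beta / 2 * n%:R `^ (2 / p - 1) * psi))%:E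
           <= Znp n p beta rho)%E &
        - eps <= n%:R `^ (1 - 2 / p) * ln w].
Proof.
move=> a0 rA a2p [x0 /= x00 hx0] eps eps0.
have /andP[p0 p1] := p01; have /andP[d0 d1] := d01.
(* [kap] is the bound allowed for the tail sum; [eta] below is chosen so that [n * eta^p = kap]. *)
pose kap := d * a `^ p; pose kq := kap `^ p^-1.
have kap0 : 0 < kap by rewrite mulr_gt0// powR_gt0.
have kq0 : 0 < kq by rewrite powR_gt0.
have q1 : 1 < p^-1 by rewrite invf_gt1.
have e10 : 1 - 2 / p < 0 by lra.
(* At most [n] coordinates each cost [eta^(-a2)], of order [n^(a2/p)], hence the extra 1; the total
   is below [n^(2/p - 1)] exactly when [a2 < 2 (1 - p)]. *)
have e20 : 1 - 2 / p + (1 + p^-1 * a2) < 0.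
  have -> : 1 - 2 / p + (1 + p^-1 * a2) = (a2 - 2 * (1 - p)) * p^-1.
    by field; rewrite gt_eqF.
  by rewrite nmulr_rlt0 ?invr_gt0// subr_lt0.
set A := [set y : R | a <= y <= (1 + d) * a] in rA.
have fA : rho A \is a fin_num.
  by apply: fin_num_measure; rewrite /A -set_itvcc.
have rA0 : 0 < fine (rho A) by rewrite fine_gt0// rA -ge0_fin_numE.
near=> n.
have kn : (k <= n)%N by near: n; exact: nbhs_infty_ge.
have n0 : (0 < n)%N by apply: leq_trans kn.
have nn0 : 0 < n%:R :> R by rewrite ltr0n.
pose eta := kq * n%:R `^ (- p^-1).
have eta0 : 0 < eta by rewrite mulr_gt0// powR_gt0.
have etap : eta `^ p = kap / n%:R.
  rewrite powRM ?powR_ge0 ?(ltW kq0)// -!powRrM mulNr mulVf ?(gt_eqF p0)//.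
  by rewrite powRr1 ?(ltW kap0)// powR_inv1 ?(ltW nn0).
have etaa : eta `^ (- a2) = kq `^ (- a2) * n%:R `^ (p^-1 * a2).
  by rewrite powRM ?powR_ge0 ?(ltW kq0)// -powRrM mulrNN.
have etax : eta < x0.
  apply: (@le_lt_trans _ _ (x0 / 2)); last lra.
  by rewrite /eta; near: n; apply: near_mul_powR_le; [lra|rewrite divr_gt0].
have [rB lnB] : (0 < rho [set y : R | (`|y| < eta)%R])%E /\
      `|ln (fine (rho [set y : R | (`|y| < eta)%R]))| <= C * eta `^ (- a2).
  by apply: hx0 => //=; rewrite sub0r normrN gtr0_norm.
set B := [set y : R | `|y| < eta] in rB lnB.
have fB : rho B \is a fin_num.
  apply: fin_num_measure; rewrite (_ : B = `]- eta, eta[%classic).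
    exact: measurable_itv.
  by apply/seteqP; split => y; rewrite /B/= in_itv/= ltr_norml.
have rB0 : 0 < fine (rho B) by rewrite fine_gt0// rB -ge0_fin_numE.
exists (fine (rho A) ^+ k * fine (rho B) ^+ (n - k)); split.
- by rewrite mulr_gt0 ?exprn_gt0.
- set c := expR _.
  have nE : (k + (n - k))%N = n by rewrite subnKC.
  rewrite -mulrA -[X in Znp X]nE.
  apply: (@Znp_ge _ _ _ p01 k (n - k) beta a d) => //.
    by rewrite mulr_ge0 ?expR_ge0// exprn_ge0// ltW.
  rewrite nE -/N -/psi -/c.
  apply: iter_int_tail_small => //; first exact: expR_ge0.
  rewrite etap -/kap mulrCA ger_pMr// ler_pdivrMr// mul1r.
  by rewrite ler_nat leq_subr.
- rewrite lnM ?posrE ?exprn_gt0// !lnXn//.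
  have h1 : C * kq `^ (- a2) * n%:R `^ (1 - 2 / p + (1 + p^-1 * a2)) <= eps / 2.
    by near: n; apply: near_mul_powR_le => //; rewrite divr_gt0.
  have h2 : - (k%:R * ln (fine (rho A))) * n%:R `^ (1 - 2 / p) <= eps / 2.
    by near: n; apply: near_mul_powR_le => //; rewrite divr_gt0.
  have h3 : - (C * eta `^ (- a2)) <= ln (fine (rho B)).
    by move: lnB; rewrite ler_norml => /andP[].
  have C0 : 0 <= C * eta `^ (- a2) by apply: le_trans lnB.
  (* Replacing [n - k] by [n] weakens the bound because, by [C0], the cost is nonnegative. *)
  have h4 : - (n%:R * (C * eta `^ (- a2))) <= (n - k)%:R * ln (fine (rho B)).
    apply: (@le_trans _ _ ((n - k)%:R * - (C * eta `^ (- a2)))).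
      by rewrite mulrN lerN2 ler_wpM2r// ler_nat leq_subr.
    by rewrite ler_wpM2l.
  rewrite -[ln _ *+ k]mulr_natl -[ln _ *+ (n - k)]mulr_natl.
  apply: (@le_trans _ _ (n%:R `^ (1 - 2 / p) *
    (k%:R * ln (fine (rho A)) - n%:R * (C * eta `^ (- a2))))).
    have nD (u v : R) : n%:R `^ (u + v) = n%:R `^ u * n%:R `^ v.
      by rewrite powRD// (gt_eqF nn0) implybT.
    move: h1; rewrite etaa (nD _ (1 + _)) (nD 1 (_ * _)) powRr1 ?(ltW nn0)//.
    set X := n%:R `^ (1 - 2 / p) in h2 *; set Y := n%:R `^ (p^-1 * a2).
    have -> : X * (k%:R * ln (fine (rho A)) - n%:R * (C * (kq `^ (- a2) * Y))) =
      k%:R * ln (fine (rho A)) * X - C * kq `^ (- a2) * (X * (n%:R * Y)) by ring.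
    by move=> h1; lra.
  by rewrite ler_wpM2l ?powR_ge0// lerD2l.
Unshelve. all: by end_near. Qed.

End LowerBound.

(** * Upper and lower bounds combined into the limit *)

Unset Implicit Arguments.

Theorem theorem1p14 (R : realType) (p : R) (rho : probability R R) :
  0 < p < 1 ->
  (* symmetric *)
  (forall A : set R, measurable A -> rho ((fun x => - x) @^-1` A) = rho A) ->
  (* finite p-th moment *)
  (\int[rho]_x (`|x| `^ p)%:E < +oo)%E ->
  (* P(X = 0) = 0 *)
  rho [set 0] = 0%E ->
  ((* condition (1) *)
   (exists C : R, 0 < C /\ exists a1 : R, a1 < 2 - p /\
      forall t : R, 1 < t ->
        \forall x \near +oo,
          (0 < rho [set y : R | (x <= y <= t * x)%R])%E /\
          `|ln (fine (rho [set y : R | (x <= y <= t * x)%R]))| <= C * x `^ a1)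
   \/
   (* condition (2) *)
   (exists C : R, 0 < C /\ exists a2 : R, a2 < 2 * (1 - p) /\
        \forall x \near 0^'+,
          (0 < rho [set y : R | (`|y| < x)%R])%E /\
          `|ln (fine (rho [set y : R | (`|y| < x)%R]))| <= C * x `^ (- a2))) ->
  forall beta : R, 0 < beta ->
    (fun n : nat => n%:R `^ (1 - 2 / p) * ln (fine (Znp n p beta rho)))
      @ \oo --> beta / 2 * tau p.
Proof.
move=> p01 sym mom r0 cond beta beta0; have /andP[p0 p1] := p01.
(* Whatever index [xget] picks has the defining property, and [tau_nat_max] holds for every such
   index. *)
have [] := xgetPex 0%N (exists_pk_interval p01).
rewrite /tau; set k := xget _ _ => k2 kp; set M := k%:R `^ _ * _.
have HM j : (0 < j)%N -> j%:R `^ (1 - 2 / p) * (j%:R - 1) <= M.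
  exact: tau_nat_max.
have k0 : (0 < k)%N by exact: leq_trans k2.
have b20 : 0 < beta / 2 by rewrite divr_gt0.
apply/cvgrPdist_le => eps eps0.
(* A loss of [eps / beta] in the ratio becomes [eps / 2] after multiplication by [beta / 2]; the
   other half is left for the weight [w]. *)
have e0 : 0 < eps / beta by rewrite divr_gt0.
have [d [d01 N0 Md]] := exists_small_spread p01 k2 e0.
have /andP[d0 d1] := d01.
have eps20 : 0 < eps / 2 by rewrite divr_gt0.
set psi := (X in M - _ <= X) in Md.
have weight : \forall n \near \oo, exists w : R,
    [/\ 0 < w,
        ((w * expR (beta / 2 * n%:R `^ (2 / p - 1) * psi))%:E
           <= Znp n p beta rho)%E &
        - (eps / 2) <= n%:R `^ (1 - 2 / p) * ln w].
  (* Condition (1) is used at [t = 1 + d]; under (2), symmetry and the absence of an atom at 0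
     provide a fixed shell of positive mass. *)
  case: cond => [[C [_ [a1 [a1p H]]]]|[C [_ [a2 [a2p H]]]]].
    apply: (near_weight_large_values p01 beta0 d01 k0 N0 mom a1p) => //.
    by apply: H; lra.
  have t1 : 1 < 1 + d by lra.
  have [a a0 ra] := exists_charged_shell sym r0 t1.
  exact: (near_weight_small_values p01 beta0 d01 k0 N0 a0 ra a2p H).
near=> n.
have n0 : (0 < n)%N by near: n; exact: nbhs_infty_gt.
have [w [w0 wZ wl]] : exists w : R,
    [/\ 0 < w,
        ((w * expR (beta / 2 * n%:R `^ (2 / p - 1) * psi))%:E
           <= Znp n p beta rho)%E &
        - (eps / 2) <= n%:R `^ (1 - 2 / p) * ln w] by near: n.
have ZM := Znp_le rho p01 n0 beta0 HM.
have /andP[lower upper] := scaled_ln_Znp_bounds n0 w0 wZ ZM.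
have b1 : beta / 2 * M - eps / 2 <= beta / 2 * psi.
  have -> : beta / 2 * M - eps / 2 = beta / 2 * (M - eps / beta).
    by field; rewrite gt_eqF.
  by rewrite ler_pM2l.
by rewrite ler_norml; lra.
Unshelve. all: by end_near. Qed.
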